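(* Let $(a_n)_{n\ge 1}$ be a sequence of real numbers such that the power series $a(z)=\sum_{n=1}^{\infty}a_nz^n$ converges at every point of $\{z\in\mathbb{C}:|z|\le1\}$. Suppose that $$1-a(z)=(1-e^{-i\theta_1}z)^{m_1}\cdots(1-e^{-i\theta_s}z)^{m_s}\,q(z),\qquad |z|\le 1,$$ where $e^{i\theta_1},\ldots,e^{i\theta_s}$ are the (distinct) possible zeros of $1-a(z)$ in the closed unit disc, $\theta_j\in\mathbb{R}$, the $m_j\geq 1$ are integers, $q(z)$ has no zero in $\{z\in\mathbb{C}:|z|\le1\}$, and $q\in\mathbb{L}^1$. Then the null solution of the Volterra difference equation $x_n=\sum_{i=0}^{n-1}a_{n-i}x_i$, $n\ge 1$, is stable if and only if the possible zeros $e^{i\theta_1},\ldots,e^{i\theta_s}$ of $1-a(z)$ are of order $1$, that is, $m_1=\cdots=m_s=1$.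
   Context: $\mathbb{L}^1$ denotes the space of power series $q(z)=\sum_{n=0}^{\infty}q_nz^n$ with $(q_n)\in\ell^1$, i.e. $\sum_{n=0}^\infty|q_n|<\infty$ (complex coefficients allowed). A solution of the equation $x_n=\sum_{i=0}^{n-1}a_{n-i}x_i$ ($n\ge1$) is the sequence $(x_n)_{n\ge 0}$ generated recursively from an initial condition $x_0\in\mathbb{R}$. The null solution is the one with $x_0=0$. The null solution is stable if for every $\varepsilon>0$ there is $\delta>0$ such that $|x_0|<\delta$ implies $|x_n|<\varepsilon$ for all $n\ge 0$. *)

(* Defs.v *)
From HB Require Import structures.
From mathcomp Require Import all_boot all_order all_algebra.
From mathcomp Require Import all_classical all_reals all_analysis.
From mathcomp Require Import complex.

Set Implicit Arguments.
Unset Strict Implicit.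
Unset Printing Implicit Defensive.

Import Order.TTheory GRing.Theory Num.Theory.
Import numFieldNormedType.Exports.

Local Open Scope classical_set_scope.
Local Open Scope ring_scope.
Local Open Scope complex_scope.

Definition expi (R : realType) (t : R) : R[i] := cos t +i* sin t.

(* Power series over an arbitrary [numFieldType] [K]: the norm topology of the
   library is attached to such a [K], and [R[i]] is an instance.  The starting
   index [k] lets [a(z)], whose coefficients are indexed from 1, and [q(z)],
   indexed from 0, share one definition. *)
Definition powser_partial (K : numFieldType) (k : nat) (c : nat -> K) (z : K) :
    nat -> K :=
  fun n => \sum_(k <= i < n) c i * z ^+ i.

Definition powser_cvg (K : numFieldType) (k : nat) (c : nat -> K) (z : K) :
    Prop :=
  cvgn (powser_partial k c z).

(* [limn] is total: the value is meaningful only under [powser_cvg k c z]. *)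
Definition powser_sum (K : numFieldType) (k : nat) (c : nat -> K) (z : K) : K :=
  limn (powser_partial k c z).

Definition ell1 (R : realType) (c : nat -> R[i]) : Prop :=
  (\sum_(0 <= n <oo) (ComplexField.Normc.normc (c n))%:E < +oo)%E.

(* [a] is indexed from 1, so [a 0] never occurs here: [n - i >= 1]. *)
Definition volterra_solution (R : realType) (a x : nat -> R) : Prop :=
  forall n : nat, (1 <= n)%N -> x n = \sum_(0 <= i < n) a (n - i)%N * x i.

Definition null_solution_stable (R : realType) (a : nat -> R) : Prop :=
  forall eps : R, 0 < eps ->
  exists2 delta : R, 0 < delta &
    forall x : nat -> R, volterra_solution a x -> `|x 0%N| < delta ->
    forall n : nat, `|x n| < eps.

(* Main.v *)
Require Import Defs.
From HB Require Import structures.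
From mathcomp Require Import all_boot all_order all_algebra.
From mathcomp Require Import all_classical all_reals all_analysis.
From mathcomp Require Import complex.
From mathcomp Require Import cyclic separable cyclotomic ring lra zify.

Set Implicit Arguments.
Unset Strict Implicit.
Unset Printing Implicit Defensive.

Import Order.TTheory GRing.Theory Num.Theory.
Import numFieldNormedType.Exports.

Local Open Scope classical_set_scope.
Local Open Scope ring_scope.
Local Open Scope complex_scope.

(** Everything is read off from formal power series. Put a_0 = 0 and
    w_j = e^(-i theta_j). A power series that sums to 0 at every point of ]0, 1[
    and has bounded coefficients is zero, so the factorization of 1 - a(z) on
    the closed disc is an identity of formal series
    1 - a = prod_j (1 - w_j X)^(m_j) * q ([factorization_fps]). On the other
    hand, for a solution x of the Volterra equation the series with coefficients
    x_n satisfies x (1 - a) = x_0 ([volterra_fps]).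

    Suppose some m_j >= 2 and write 1 - a = (1 - w_j X)^2 F with F in l^1. For a
    bounded solution x with x_0 <> 0 the series x F = x_0 / (1 - w_j X)^2 would
    have bounded coefficients, being the product of a bounded sequence and an
    l^1 sequence; but its coefficients are x_0 (n + 1) w_j^n
    ([not_stable_of_double]).

    Suppose all m_j = 1. Then y = x prod_j (1 - w_j X) satisfies y q = x_0, and
    x = y / prod_j (1 - w_j X), where 1 / prod_j (1 - w_j X) has bounded
    coefficients by partial fractions ([linear_factors_bounded_inverse]). It is
    enough that |y|_1 <= C |x_0|, which is Wiener's lemma for the series q: it
    has no zero in the closed disc, hence an inverse in l^1. What is used of it is a
    series g in l^1 with |1 - q g|_1 <= 1/2 ([near_inverse]), because
    y = x_0 g + y (1 - q g) then gives |y|_1 <= 2 |x_0| |g|_1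
    ([l1_of_near_inverse]).

    The series g is found as in Newman's proof of Wiener's lemma. By
    compactness of the disc, all long enough truncations P of q satisfy
    |P| >= d > 0 on the disc ([trunc_lower_bound]); choose one such that
    h = P - q has norm at most d/3. The polynomial P still satisfies
    |P| >= d/2 on a slightly larger disc, so 1/P is a product of geometric
    series, and Cauchy's estimate on the larger circle yields
    |P^(-N)|_1 <= C (2/d)^N ([poly_inverse_powers]). Cauchy's estimate for a
    polynomial is an average over roots of unity ([poly_coef_bound]). Finally
    q = P - h divides P^N - h^N, and g = P^(-N) (P^N - h^N) / q satisfies
    1 - q g = P^(-N) h^N, of norm at most C (2/3)^N. *)

(** * The ring of formal power series *)

(** A copy of nat -> K, whose ring structure is given by convolution and not by
    pointwise multiplication. *)
Definition fps (K : comNzRingType) : Type := nat -> K.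

HB.instance Definition _ (K : comNzRingType) := gen_eqMixin (fps K).
HB.instance Definition _ (K : comNzRingType) := gen_choiceMixin (fps K).

Definition fps_add (K : comNzRingType) (c d : fps K) : fps K := fun n => c n + d n.
Definition fps_opp (K : comNzRingType) (c : fps K) : fps K := fun n => - c n.

Lemma fps_addA (K : comNzRingType) : associative (@fps_add K).
Proof. by move=> a b c; apply: funext => n; rewrite /fps_add addrA. Qed.
Lemma fps_addC (K : comNzRingType) : commutative (@fps_add K).
Proof. by move=> a b; apply: funext => n; rewrite /fps_add addrC. Qed.
Lemma fps_add0 (K : comNzRingType) : left_id (fun=> 0) (@fps_add K).
Proof. by move=> a; apply: funext => n; rewrite /fps_add add0r. Qed.
Lemma fps_addN (K : comNzRingType) :
  left_inverse (fun=> 0) (@fps_opp K) (@fps_add K).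
Proof. by move=> a; apply: funext => n; rewrite /fps_add /fps_opp addNr. Qed.

HB.instance Definition _ (K : comNzRingType) := GRing.isZmodule.Build (fps K)
  (@fps_addA K) (@fps_addC K) (@fps_add0 K) (@fps_addN K).

Definition fps_mul (K : comNzRingType) (c d : fps K) : fps K :=
  fun n => \sum_(i < n.+1) c i * d (n - i)%N.

Definition fps_of_poly (K : comNzRingType) (p : {poly K}) : fps K := fun n => p`_n.

Definition trunc (K : comNzRingType) (N : nat) (c : fps K) : {poly K} :=
  \poly_(i < N) c i.

Lemma coef_trunc (K : comNzRingType) N (c : fps K) n :
  (n < N)%N -> (trunc N c)`_n = c n.
Proof. by move=> nN; rewrite coef_poly nN. Qed.

(** Coefficients of a product only depend on finitely many coefficients of the
    factors, which transfers the ring axioms from polynomials. *)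
Lemma fps_mul_trunc (K : comNzRingType) N (c d : fps K) n :
  (n < N)%N -> fps_mul c d n = (trunc N c * trunc N d)`_n.
Proof.
move=> nN; rewrite coefM; apply: eq_bigr => i _.
by rewrite !coef_trunc //; have := ltn_ord i; lia.
Qed.

Lemma coefM_low (K : comNzRingType) N (p p' r r' : {poly K}) n :
  (forall i, (i < N)%N -> p`_i = p'`_i) -> (forall i, (i < N)%N -> r`_i = r'`_i) ->
  (n < N)%N -> (p * r)`_n = (p' * r')`_n.
Proof.
move=> hp hr nN; rewrite !coefM; apply: eq_bigr => i _.
by rewrite hp ?hr //; have := ltn_ord i; lia.
Qed.

Lemma fps_mulA (K : comNzRingType) : associative (@fps_mul K).
Proof.
move=> a b c; apply: funext => n; set N := n.+1.
rewrite !(@fps_mul_trunc _ N) //.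
transitivity ((trunc N a * trunc N b * trunc N c)`_n).
  rewrite -mulrA; apply: (@coefM_low _ N) => // i iN.
  by rewrite coef_trunc // (@fps_mul_trunc _ N).
apply: (@coefM_low _ N) => // i iN.
by rewrite coef_trunc // (@fps_mul_trunc _ N).
Qed.

Lemma fps_mulC (K : comNzRingType) : commutative (@fps_mul K).
Proof.
by move=> a b; apply: funext => n; rewrite !(@fps_mul_trunc _ n.+1) // mulrC.
Qed.

Definition fps_one (K : comNzRingType) : fps K := fps_of_poly 1.

Lemma fps_mul1 (K : comNzRingType) : left_id (@fps_one K) (@fps_mul K).
Proof.
move=> a; apply: funext => n.
rewrite /fps_mul big_ord_recl subn0 /fps_one /fps_of_poly coef1 eqxx mul1r.
rewrite big1 ?addr0 //.
by move=> i _; rewrite coef1 mul0r.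
Qed.

Lemma fps_mulDl (K : comNzRingType) : left_distributive (@fps_mul K) (@fps_add K).
Proof.
move=> a b c; apply: funext => n; rewrite /fps_mul /fps_add -big_split /=.
by apply: eq_bigr => i _; rewrite mulrDl.
Qed.

Lemma fps_one_neq0 (K : comNzRingType) : @fps_one K != 0.
Proof.
apply/eqP => /(congr1 (fun f : fps K => f 0%N)) /eqP.
by rewrite /fps_one /fps_of_poly coef1 (oner_eq0 K).
Qed.

HB.instance Definition _ (K : comNzRingType) :=
  GRing.Zmodule_isComNzRing.Build (fps K) (@fps_mulA K) (@fps_mulC K)
    (@fps_mul1 K) (@fps_mulDl K) (@fps_one_neq0 K).

Lemma fps_of_poly_is_additive (K : comNzRingType) : additive (@fps_of_poly K).
Proof. by move=> p q; apply: funext => n; rewrite /fps_of_poly coefB. Qed.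

Lemma fps_of_poly_is_multiplicative (K : comNzRingType) :
  multiplicative (@fps_of_poly K).
Proof. by split=> // p q; apply: funext => n; rewrite /fps_of_poly coefM. Qed.

HB.instance Definition _ (K : comNzRingType) :=
  GRing.isAdditive.Build {poly K} (fps K) (@fps_of_poly K)
    (@fps_of_poly_is_additive K).
HB.instance Definition _ (K : comNzRingType) :=
  GRing.isMultiplicative.Build {poly K} (fps K) (@fps_of_poly K)
    (@fps_of_poly_is_multiplicative K).

Lemma fpsDE (K : comNzRingType) (c d : fps K) n : (c + d) n = c n + d n.
Proof. by []. Qed.
Lemma fpsNE (K : comNzRingType) (c : fps K) n : (- c) n = - c n.
Proof. by []. Qed.
Lemma fps1E (K : comNzRingType) n : (1 : fps K) n = (n == 0%N)%:R.
Proof. exact: coef1. Qed.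
Lemma fpsME (K : comNzRingType) (c d : fps K) n :
  (c * d) n = \sum_(i < n.+1) c i * d (n - i)%N.
Proof. by []. Qed.

Definition geom (K : comNzRingType) (w : K) : fps K := fun n => w ^+ n.

Definition linear_factor (K : comNzRingType) (w : K) : {poly K} := 1 - w *: 'X.

Lemma fpsM_linear_factorS (K : comNzRingType) (w : K) (c : fps K) n :
  (fps_of_poly (linear_factor w) * c) n.+1 = c n.+1 - w * c n.
Proof.
rewrite fpsME !big_ord_recl big1 /= ?addr0 => [|i _]; last first.
  by rewrite /fps_of_poly coefB coef1 coefZ coefX /= mulr0 subr0 mul0r.
by rewrite /fps_of_poly !coefB !coef1 !coefZ !coefX /= mulr0 subr0 mulr1 sub0r
  mul1r mulNr subn0 subn1.
Qed.

Lemma fpsM_coef0 (K : comNzRingType) (c d : fps K) : (c * d) 0%N = c 0%N * d 0%N.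
Proof. by rewrite fpsME big_ord1. Qed.

Lemma linear_factor_geom (K : comNzRingType) (w : K) :
  fps_of_poly (linear_factor w) * geom w = 1.
Proof.
apply: funext => -[|n].
  by rewrite fpsM_coef0 fps1E /fps_of_poly coefB coef1 coefZ coefX
    /= mulr0 subr0 mul1r /geom expr0.
rewrite fpsM_linear_factorS /geom. by rewrite exprS subrr fps1E.
Qed.

(** * The real-valued modulus *)

Notation normc := ComplexField.Normc.normc.
Arguments ComplexField.Normc.normc {R} x : simpl never.

Lemma normcE (R : rcfType) (z : R[i]) : `|z| = (normc z)%:C.
Proof. by []. Qed.

Lemma normc_ge0 (R : rcfType) (z : R[i]) : 0 <= normc z.
Proof. exact: (normr_ge0 (z : Rcomplex R)). Qed.

Lemma normc_sum (R : rcfType) (I : Type) (r : seq I) (P : pred I) (F : I -> R[i]) :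
  normc (\sum_(i <- r | P i) F i) <= \sum_(i <- r | P i) normc (F i).
Proof. exact: (ler_norm_sum r (F : I -> Rcomplex R) P). Qed.

Lemma normcD_le (R : rcfType) (z w : R[i]) : normc (z + w) <= normc z + normc w.
Proof. exact: le_normcD. Qed.

Lemma normcB_le (R : rcfType) (z w : R[i]) : normc (z - w) <= normc z + normc w.
Proof. by rewrite -(normcN w); exact: le_normcD. Qed.

Lemma normcB_ge (R : rcfType) (z w : R[i]) : normc z - normc w <= normc (z + w).
Proof.
by rewrite lerBlDr -(normcN w); apply: le_trans (normcD_le _ _); rewrite addrK.
Qed.

Lemma normc_distC (R : rcfType) (z w : R[i]) : normc (z - w) = normc (w - z).
Proof. by rewrite -(normcN (z - w : Rcomplex R)) opprB. Qed.

Lemma normcM (R : rcfType) (z w : R[i]) : normc (z * w) = normc z * normc w.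
Proof. exact: Normc.normcM. Qed.

Lemma normcX (R : rcfType) (z : R[i]) n : normc (z ^+ n) = normc z ^+ n.
Proof.
elim: n => [|n IH]; first by rewrite !expr0 Normc.normc1.
by rewrite !exprS normcM IH.
Qed.

Lemma normc_eq0 (R : rcfType) (z : R[i]) : (normc z == 0) = (z == 0).
Proof.
by apply/eqP/eqP => [|->]; [exact: Normc.eq0_normc|exact: Normc.normc0].
Qed.

Lemma normc_real (R : rcfType) (x : R) : normc x%:C = `|x|.
Proof. by rewrite /normc /= expr0n /= addr0 sqrtr_sqr. Qed.

(** * Summable and bounded coefficient sequences *)

Definition l1le (R : rcfType) (c : fps R[i]) (M : R) : Prop :=
  forall N, \sum_(k < N) normc (c k) <= M.

Definition bounded_by (R : rcfType) (c : fps R[i]) (B : R) : Prop :=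
  forall n, normc (c n) <= B.

Lemma l1le_ge0 (R : rcfType) (c : fps R[i]) M : l1le c M -> 0 <= M.
Proof. by move=> /(_ 0%N); rewrite big_ord0. Qed.

Lemma l1leD (R : rcfType) (c d : fps R[i]) M N :
  l1le c M -> l1le d N -> l1le (c + d) (M + N).
Proof.
move=> hc hd K; apply: le_trans (lerD (hc K) (hd K)).
by rewrite -big_split /=; apply: ler_sum => k _; exact: normcD_le.
Qed.

Lemma l1leN (R : rcfType) (c : fps R[i]) M : l1le c M -> l1le (- c) M.
Proof.
by move=> hc K; under eq_bigr do rewrite fpsNE (normcN (c _)); exact: hc.
Qed.

Lemma bounded_byD (R : rcfType) (c d : fps R[i]) M N :
  bounded_by c M -> bounded_by d N -> bounded_by (c + d) (M + N).
Proof. by move=> hc hd n; apply: le_trans (lerD (hc n) (hd n)); exact: normcD_le. Qed.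

(** Both sides sum F over the triangle i + j < N. *)
Lemma conv_sum_exchange (R : nmodType) N (F : nat -> nat -> R) :
  \sum_(n < N) \sum_(i < n.+1) F i (n - i)%N =
  \sum_(i < N) \sum_(j < N - i) F i j.
Proof.
elim: N => [|N IH]; first by rewrite !big_ord0.
rewrite big_ord_recr /= IH [in RHS]big_ord_recr /= subSnn big_ord1.
rewrite [in LHS]big_ord_recr /= subnn addrA; congr (_ + _).
rewrite -big_split /=; apply: eq_bigr => i _.
by rewrite subSn ?big_ord_recr //= ltnW.
Qed.

(** A bound for partial sums, which does not ask that c be summable: it applies
    to a series whose summability is still to be proved. *)
Lemma psum_normM (R : rcfType) (c d : fps R[i]) N K :
  l1le d N ->
  \sum_(k < K) normc ((c * d) k) <= (\sum_(k < K) normc (c k)) * N.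
Proof.
move=> hd.
apply: (@le_trans _ _
  (\sum_(n < K) \sum_(i < n.+1) normc (c i) * normc (d (n - i)%N))).
  apply: ler_sum => n _; rewrite fpsME; apply: le_trans (normc_sum _ _ _) _.
  by apply: ler_sum => i _; rewrite normcM.
rewrite (conv_sum_exchange K (fun i j => normc (c i) * normc (d j))) mulr_suml.
by apply: ler_sum => i _; rewrite -mulr_sumr ler_wpM2l ?normc_ge0 //; exact: hd.
Qed.

Lemma l1leM (R : rcfType) (c d : fps R[i]) M N :
  l1le c M -> l1le d N -> l1le (c * d) (M * N).
Proof.
move=> hc hd K; apply: le_trans (psum_normM c K hd) _.
by rewrite ler_wpM2r ?(l1le_ge0 hd).
Qed.

Lemma l1le1 (R : rcfType) : l1le (1 : fps R[i]) 1.
Proof.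
case=> [|N]; first by rewrite big_ord0.
rewrite big_ord_recl fps1E Normc.normc1 big1 ?addr0 // => i _.
by rewrite fps1E Normc.normc0.
Qed.

Lemma l1leX (R : rcfType) (c : fps R[i]) M n :
  l1le c M -> l1le (c ^+ n) (M ^+ n).
Proof.
move=> hc; elim: n => [|n IH]; last by rewrite !exprS; exact: l1leM.
by rewrite !expr0; exact: l1le1.
Qed.

Lemma bounded_byM_l1 (R : rcfType) (c d : fps R[i]) B M :
  bounded_by c B -> l1le d M -> bounded_by (c * d) (B * M).
Proof.
move=> hc hd n; rewrite mulrC fpsME; apply: le_trans (normc_sum _ _ _) _.
apply: (@le_trans _ _ (\sum_(i < n.+1) normc (d i) * B)).
  by apply: ler_sum => i _; rewrite normcM ler_wpM2l ?normc_ge0.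
by rewrite -mulr_suml mulrC ler_wpM2l // (le_trans (normc_ge0 _) (hc 0%N)).
Qed.

Lemma l1le_bounded (R : rcfType) (c : fps R[i]) M : l1le c M -> bounded_by c M.
Proof.
move=> hc n; apply: le_trans (hc n.+1); rewrite big_ord_recr /= lerDr.
by apply: sumr_ge0 => i _; exact: normc_ge0.
Qed.

Lemma l1le_le (R : rcfType) (c : fps R[i]) M M' : l1le c M -> M <= M' -> l1le c M'.
Proof. by move=> hc hM K; apply: le_trans hM; exact: hc. Qed.

Definition in_l1 (R : rcfType) (c : fps R[i]) : Prop := exists M, l1le c M.

Lemma in_l1D (R : rcfType) (c d : fps R[i]) :
  in_l1 c -> in_l1 d -> in_l1 (c + d).
Proof. by move=> [M hM] [N hN]; exists (M + N); exact: l1leD. Qed.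

Lemma in_l1M (R : rcfType) (c d : fps R[i]) :
  in_l1 c -> in_l1 d -> in_l1 (c * d).
Proof. by move=> [M hM] [N hN]; exists (M * N); exact: l1leM. Qed.

Lemma in_l1X (R : rcfType) (c : fps R[i]) n : in_l1 c -> in_l1 (c ^+ n).
Proof. by move=> [M hM]; exists (M ^+ n); exact: l1leX. Qed.

Lemma in_l1_prod (R : rcfType) (I : Type) (r : seq I) (P : pred I)
    (F : I -> fps R[i]) :
  (forall i, P i -> in_l1 (F i)) -> in_l1 (\prod_(i <- r | P i) F i).
Proof.
move=> hF; elim/big_ind: _ => //; first by exists 1; exact: l1le1.
exact: in_l1M.
Qed.

Lemma in_l1_sum (R : rcfType) (I : Type) (r : seq I) (P : pred I)
    (F : I -> fps R[i]) :
  (forall i, P i -> in_l1 (F i)) -> in_l1 (\sum_(i <- r | P i) F i).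
Proof.
move=> hF; elim/big_ind: _ => //; last exact: in_l1D.
by exists 0 => K; rewrite big1 // => i _; exact: Normc.normc0.
Qed.

Lemma in_l1_poly (R : rcfType) (p : {poly R[i]}) : in_l1 (fps_of_poly p).
Proof.
exists (\sum_(k < size p) normc p`_k) => K; rewrite /fps_of_poly.
have [h|h] := leqP K (size p).
  by rewrite -(subnKC h) big_split_ord /= lerDl sumr_ge0 // => i _; exact: normc_ge0.
rewrite -(subnKC (ltnW h)) big_split_ord /= gerDl big1 // => i _.
by rewrite nth_default ?Normc.normc0 // leq_addr.
Qed.

Lemma l1le_geometric (R : rcfType) (c : fps R[i]) (B r : R) :
  0 <= r -> r < 1 -> (forall n, normc (c n) <= B * r ^+ n) ->
  l1le c (B / (1 - r)).
Proof.
move=> r0 r1 hc K.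
have B0 : 0 <= B by have := le_trans (normc_ge0 _) (hc 0%N); rewrite expr0 mulr1.
apply: (@le_trans _ _ (\sum_(k < K) B * r ^+ k)).
  by apply: ler_sum => k _; exact: hc.
rewrite -mulr_sumr ler_wpM2l // -[leRHS]mul1r ler_pdivlMr ?subr_gt0 // mulrC.
by rewrite -opprB mulNr -subrX1 opprB gerBl exprn_ge0.
Qed.

Lemma in_l1_geom (R : rcfType) (w : R[i]) : normc w < 1 -> in_l1 (geom w).
Proof.
move=> w1; exists (1 / (1 - normc w)).
by apply: l1le_geometric; rewrite ?normc_ge0 // => n; rewrite mul1r normcX.
Qed.

Lemma tail_small (R : realType) (c : fps R[i]) (eps : R) : in_l1 c -> 0 < eps ->
  exists L, forall K, (L <= K)%N -> l1le (c - fps_of_poly (trunc K c)) eps.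
Proof.
move=> [M hM] e0; pose S := fun N => \sum_(k < N) normc (c k).
have hS : has_sup (range S).
  by split; [exists (S 0%N), 0%N | exists M => _ [N _ <-]; exact: hM].
have [_ [L _ <-] hL] := sup_adherent e0 hS.
have Smono i j : (i <= j)%N -> S i <= S j.
  move=> ij; rewrite /S -(subnKC ij) big_split_ord /= lerDl sumr_ge0 // => k _.
  exact: normc_ge0.
exists L => K LK N.
have cE k : (c - fps_of_poly (trunc K c)) k = if (k < K)%N then 0 else c k.
  by rewrite fpsDE fpsNE /fps_of_poly coef_poly; case: ifP; rewrite ?subrr ?subr0.
under eq_bigr do rewrite cE.
have [h|h] := leqP N K.
  rewrite big1 ?(ltW e0) // => i _; rewrite (leq_trans (ltn_ord i) h).
  exact: Normc.normc0.
have := sup_upper_bound hS; move=> /(_ (S N)) /(_ (imageT _ _)) hN.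
have -> : \sum_(k < N) normc (if (k < K)%N then 0 else c k) = S N - S K.
  rewrite /S -(subnKC (ltnW h)) !big_split_ord /=.
  rewrite big1 => [|i _]; last by rewrite ltn_ord; exact: Normc.normc0.
  rewrite add0r [in RHS]addrAC subrr add0r; apply: eq_bigr => i _.
  by rewrite ltnNge leq_addr.
have := Smono _ _ LK; lra.
Qed.

(** * Wiener's lemma: approximate inverses in l^1 *)

Lemma prim_root_exists (F : numClosedFieldType) n :
  (0 < n)%N -> exists w : F, n.-primitive_root w.
Proof.
move=> n_gt0; pose p : {poly F} := 'X^n - 1.
have [r Dp] := closed_field_poly_normal p.
rewrite (monicP _) ?monicXnsubC // scale1r in Dp.
have rn1 : all n.-unity_root r by apply/allP => z; rewrite -root_prod_XsubC -Dp.
have sz_r : (n <= size r)%N.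
  by rewrite -ltnS -(size_prod_XsubC r id) -Dp size_XnsubC.
have [|w] := hasP (has_prim_root n_gt0 rn1 _ sz_r); last by exists w.
by rewrite -separable_prod_XsubC -Dp separable_Xn_sub_1 // pnatr_eq0 -lt0n.
Qed.

Lemma sum_prim_root (F : fieldType) N (w : F) (k l : nat) :
  N.-primitive_root w -> (k < N)%N -> (l < N)%N ->
  \sum_(j < N) (w ^+ j) ^+ l * (w ^+ j) ^- k = (if l == k then N%:R else 0).
Proof.
move=> hw kN lN; have w0 : w != 0.
  by apply/eqP => w0; have /eqP := prim_expr_order hw; rewrite w0 expr0n
    gtn_eqF ?(prim_order_gt0 hw) // eq_sym oner_eq0.
pose z := w ^+ l / w ^+ k.
transitivity (\sum_(j < N) z ^+ j).
  by apply: eq_bigr => j _; rewrite /z expr_div_n -!exprM ![(j * _)%N]mulnC.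
have [lk|lk] := eqVneq l k.
  have -> : z = 1 by rewrite /z lk divff ?expf_neq0.
  by under eq_bigr do rewrite expr1n; rewrite sumr_const card_ord.
have z1 : z != 1.
  apply: contra lk => /eqP hz.
  have : w ^+ l == w ^+ k by rewrite -(divfK (expf_neq0 k w0) (w ^+ l)) -/z hz mul1r.
  by rewrite (eq_prim_root_expr hw) !modn_small.
have : (z - 1) * \sum_(j < N) z ^+ j = 0.
  rewrite -subrX1 /z expr_div_n -!exprM ![(_ * N)%N]mulnC !exprM.
  by rewrite (prim_expr_order hw) !expr1n divr1 subrr.
by move/eqP; rewrite mulf_eq0 subr_eq0 (negbTE z1) => /eqP.
Qed.

Lemma normc_unity_root (R : rcfType) N (w : R[i]) :
  (0 < N)%N -> w ^+ N = 1 -> normc w = 1.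
Proof.
move=> N0 hw; have /eqP : normc w ^+ N = 1 by rewrite -normcX hw Normc.normc1.
by rewrite pexpr_eq1 ?normc_ge0 // => /eqP.
Qed.

(** Cauchy's estimate on the unit circle: for N > deg V the N-th roots of unity z
    satisfy sum_z V(z) z^(-k) = N V_k. *)
Lemma poly_coef_bound (R : rcfType) (V : {poly R[i]}) (B : R) k :
  (forall z, normc z = 1 -> normc V.[z] <= B) -> normc V`_k <= B.
Proof.
move=> hB; pose N := maxn (size V) k.+1.
have N0 : (0 < N)%N by rewrite /N; lia.
have kN : (k < N)%N by rewrite /N; lia.
have [w hw] := @prim_root_exists R[i] N N0.
have w1 j : normc (w ^+ j) = 1.
  by rewrite normcX (normc_unity_root N0) ?expr1n // (prim_expr_order hw).
have E : \sum_(j < N) V.[w ^+ j] * (w ^+ j) ^- k = N%:R * V`_k.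
  under eq_bigr do rewrite (@horner_coef_wide _ N) ?leq_maxl // mulr_suml.
  rewrite exchange_big /= (bigD1 (Ordinal kN)) //= [X in _ + X]big1 ?addr0.
    under eq_bigr do rewrite -mulrA.
    by rewrite -mulr_sumr sum_prim_root // eqxx mulrC.
  move=> i ik; under eq_bigr do rewrite -mulrA.
  rewrite -mulr_sumr sum_prim_root // ifN ?mulr0 //.
have NR : normc (N%:R : R[i]) = N%:R.
  by have := normc_real (N%:R : R); rewrite rmorph_nat => ->; rewrite ger0_norm ?ler0n.
have N0R : 0 < N%:R :> R by rewrite ltr0n.
rewrite -(ler_pM2l N0R) -{1}NR -normcM -E.
apply: le_trans (normc_sum _ _ _) _.
apply: (@le_trans _ _ (\sum_(j < N) B)); last by rewrite sumr_const card_ord mulr_natl.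
apply: ler_sum => j _; rewrite normcM -exprVn normcX Normc.normcV w1 invr1 expr1n mulr1.
by apply: hB.
Qed.

Lemma normc_horner_le (R : rcfType) (p : {poly R[i]}) (M : R) (z : R[i]) :
  l1le (fps_of_poly p) M -> normc z <= 1 -> normc p.[z] <= M.
Proof.
move=> hM z1; rewrite horner_coef; apply: le_trans (normc_sum _ _ _) _.
apply: le_trans (hM (size p)); apply: ler_sum => i _.
rewrite normcM normcX -[leRHS]mulr1 ler_wpM2l ?normc_ge0 //.
by rewrite exprn_ile1 // normc_ge0.
Qed.

(** Cauchy's estimate for the power series u = 1/Q. A long truncation V of u is a
    polynomial for which V Q - 1 is small in l^1, hence small on the circle, so
    that |V| is almost at most 1/c there. *)
Lemma inverse_coef_bound (R : realType) (u : fps R[i]) (Q : {poly R[i]}) (c : R) :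
  in_l1 u -> u * fps_of_poly Q = 1 -> 0 < c ->
  (forall z, normc z = 1 -> c <= normc Q.[z]) -> bounded_by u c^-1.
Proof.
move=> hu uQ c0 hQ k; have [M hM] := in_l1_poly Q.
have M0 := l1le_ge0 hM.
apply/ler_addgt0Pr => eps e0.
have e'0 : 0 < eps * c / (M + 1) by rewrite divr_gt0 ?mulr_gt0 // ltr_wpDl.
have [L hL] := tail_small hu e'0.
pose K := maxn L k.+1; have {hL}hL := hL K (leq_maxl _ _).
set V := trunc K u in hL.
have -> : u k = V`_k by rewrite coef_trunc // leq_maxr.
apply: poly_coef_bound => z z1.
have hE : l1le (fps_of_poly (1 - V * Q)) (eps * c).
  have -> : fps_of_poly (1 - V * Q) = (u - fps_of_poly V) * fps_of_poly Q.
    by rewrite rmorphB rmorphM mulrBl uQ.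
  apply: l1le_le (l1leM hL hM) _.
  rewrite mulrAC ler_pdivrMr ?ltr_wpDl // ler_wpM2l ?lerDl //.
  by rewrite mulr_ge0 // ltW.
have := normc_horner_le hE (z := z); rewrite z1 => /(_ (lexx _)).
rewrite hornerD hornerN hornerM hornerC normc_distC => h1.
have : normc (V.[z] * Q.[z]) <= 1 + eps * c.
  have := normcD_le (V.[z] * Q.[z] - 1) 1; rewrite subrK Normc.normc1; lra.
rewrite normcM => h2.
have h3 : normc V.[z] * c <= 1 + eps * c.
  by apply: le_trans h2; rewrite ler_wpM2l ?normc_ge0 // hQ.
by rewrite -(ler_pM2r c0) mulrDl mulVf ?gt_eqF.
Qed.

(** Over an algebraically closed field Q is a product of linear factors, and each
    of them is inverted by a geometric series of ratio less than 1. *)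
Lemma poly_inverse_in_l1 (R : rcfType) (Q : {poly R[i]}) :
  (forall z, normc z <= 1 -> Q.[z] != 0) ->
  exists2 u, in_l1 u & u * fps_of_poly Q = 1.
Proof.
move=> hQ; have [r Dr] := closed_field_poly_normal Q.
have l0 : lead_coef Q != 0.
  rewrite lead_coef_eq0; apply: contraTneq (hQ 0 _) => [->|].
    by rewrite horner0 eqxx.
  by rewrite Normc.normc0.
pose I (p : {poly R[i]}) := exists2 u, in_l1 u & u * fps_of_poly p = 1.
have IM p p' : I p -> I p' -> I (p * p').
  move=> [u su hu] [v sv hv]; exists (u * v); first exact: in_l1M.
  by rewrite rmorphM mulrACA hu hv mulr1.
have IC c : c != 0 -> I c%:P.
  move=> c0; exists (fps_of_poly c^-1%:P); first exact: in_l1_poly.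
  by rewrite -rmorphM -polyCM mulVf // rmorph1.
suff : I (lead_coef Q *: \prod_(z <- r) ('X - z%:P)) by rewrite -Dr.
rewrite -mul_polyC; apply: (IM); first exact: IC.
rewrite big_seq; apply: (big_ind I) => [||z zr].
- exact: (IC 1 (oner_neq0 _)).
- exact: IM.
have z1 : 1 < normc z.
  rewrite ltNge; apply/negP => /hQ; rewrite Dr hornerZ mulf_eq0 negb_or l0 /=.
  by rewrite -/(root _ _) root_prod_XsubC zr.
have z0 : z != 0 by rewrite -normc_eq0 gt_eqF // (lt_trans ltr01).
have -> : 'X - z%:P = (- z)%:P * linear_factor z^-1.
  rewrite /linear_factor mulrBr mulr1 polyCN mulNr opprK mul_polyC.
  rewrite scalerA divff // scale1r.
  by rewrite addrC.
apply: IM; first by apply: IC; rewrite oppr_eq0.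
exists (geom z^-1); last by rewrite mulrC linear_factor_geom.
by apply: in_l1_geom; rewrite Normc.normcV invf_lt1 // (lt_trans ltr01).
Qed.

Definition fps_scale (K : comNzRingType) (t : K) (c : fps K) : fps K :=
  fun n => c n * t ^+ n.

Lemma fps_scaleM (K : comNzRingType) (t : K) : {morph fps_scale t : c d / c * d}.
Proof.
move=> c d; apply: funext => n; rewrite /fps_scale !fpsME mulr_suml.
apply: eq_bigr => i _; rewrite mulrACA -exprD subnKC //.
by have := ltn_ord i; lia.
Qed.

Lemma fps_scale1 (K : comNzRingType) (t : K) : fps_scale t 1 = 1.
Proof.
apply: funext => n; rewrite /fps_scale !fps1E.
by case: n => [|n]; rewrite ?mul0r // expr0 mulr1.
Qed.

Lemma fps_scaleX (K : comNzRingType) (t : K) (c : fps K) n :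
  fps_scale t (c ^+ n) = fps_scale t c ^+ n.
Proof.
by elim: n => [|n IH]; rewrite ?expr0 ?fps_scale1 // !exprS fps_scaleM IH.
Qed.

Lemma horner_lipschitz (R : rcfType) (p : {poly R[i]}) (B : R) : 0 <= B ->
  exists2 C, 0 <= C & forall z w, normc z <= B -> normc w <= B ->
    normc (p.[z] - p.[w]) <= C * normc (z - w).
Proof.
move=> B0.
(* The induction also needs a bound D for p itself on the disc. *)
suff [D [C [D0 C0 h]]] : exists D C, [/\ 0 <= D, 0 <= C &
    forall z, normc z <= B -> normc p.[z] <= D /\ forall w, normc w <= B ->
      normc (p.[z] - p.[w]) <= C * normc (z - w)].
  by exists C => // z w hz hw; have [_] := h z hz; apply.
elim/poly_ind: p => [|p c [D [C [D0 C0 h]]]].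
  exists 0, 0; split=> // z hz; rewrite horner0 Normc.normc0; split=> // w hw.
  by rewrite horner0 subrr Normc.normc0 mul0r.
exists (D * B + normc c), (D + B * C); split.
- by rewrite addr_ge0 ?mulr_ge0 ?normc_ge0.
- by rewrite addr_ge0 ?mulr_ge0.
move=> z hz; have [hzD hL] := h z hz; split=> [|w hw].
  rewrite !hornerE; apply: le_trans (normcD_le _ _) _; rewrite lerD2r normcM.
  by rewrite ler_pM ?normc_ge0.
rewrite !hornerE.
have -> : p.[z] * z + c - (p.[w] * w + c) = p.[z] * (z - w) + (p.[z] - p.[w]) * w.
  by ring.
apply: le_trans (normcD_le _ _) _; rewrite !normcM mulrDl lerD //.
  by rewrite ler_wpM2r ?normc_ge0.
by rewrite mulrC -mulrA ler_pM ?normc_ge0 // hL.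
Qed.

(** The bounds C d'^(-N) come from a circle of radius rho > 1 on which |P| >= d'
    still holds: there Cauchy's estimate bounds the n-th coefficient of P^(-N)
    by d'^(-N) rho^(-n), and these bounds have a finite sum. The circle is
    rescaled to the unit circle by passing to Q(z) = P(rho z). *)
Lemma poly_inverse_powers (R : realType) (P : {poly R[i]}) (d d' : R) :
  0 < d' -> d' < d -> (forall z, normc z <= 1 -> d <= normc P.[z]) ->
  exists u C, [/\ u * fps_of_poly P = 1, in_l1 u &
    forall N, l1le (u ^+ N) (C * (d'^-1) ^+ N)].
Proof.
move=> d'0 dd' hP.
have B0 : 0 <= 2 :> R by [].
have [L L0 hL] := horner_lipschitz P B0.
(* rho - 1 is so small that P changes by at most d - d' between z and rho z. *)
pose eta : R := Num.min 1 ((d - d') / (L + 1)).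
have L1 : 0 < L + 1 by rewrite ltr_wpDl.
have eta0 : 0 < eta by rewrite /eta lt_min ltr01 divr_gt0 // subr_gt0.
have eta1 : eta <= 1 by rewrite /eta ge_min lexx.
have etaL : L * eta <= d - d'.
  apply: (@le_trans _ _ ((L + 1) * eta)); first by rewrite ler_wpM2r ?ltW //; lra.
  by rewrite mulrC -ler_pdivlMr // /eta ge_min lexx orbT.
pose rho : R := 1 + eta.
have rho1 : 1 < rho by rewrite /rho; lra.
have rho0 : 0 < rho by lra.
have rhoC0 : rho%:C != 0 :> R[i] by rewrite -normc_eq0 normc_real normr_eq0 gt_eqF.
pose Q := \poly_(i < size P) (P`_i * rho%:C ^+ i).
have QE z : Q.[z] = P.[rho%:C * z].
  rewrite horner_poly horner_coef; apply: eq_bigr => i _.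
  by rewrite exprMn mulrA.
have hQ z : normc z <= 1 -> d' <= normc Q.[z].
  move=> z1; rewrite QE.
  have := hL (rho%:C * z) z _ _; have := normc_ge0 z => zge0.
  have nrz : normc (rho%:C * z) <= 2.
    rewrite normcM normc_real gtr0_norm //.
    by apply: (@le_trans _ _ (rho * 1)); rewrite ?ler_pM2l // /rho; lra.
  move=> /(_ nrz); have -> : rho%:C * z - z = eta%:C * z.
    by rewrite /rho rmorphD rmorph1 mulrDl mul1r addrAC subrr add0r.
  rewrite normcM (normc_real eta) gtr0_norm // => /(_ (le_trans z1 _)) hh.
  have {}hh : normc (P.[rho%:C * z] - P.[z]) <= L * (eta * normc z) by apply: hh; lra.
  have h1 : L * (eta * normc z) <= d - d'.
    apply: le_trans etaL; rewrite ler_wpM2l // -[leRHS]mulr1 ler_wpM2l //; exact: ltW.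
  have := hP z z1; have := normcB_ge P.[z] (P.[rho%:C * z] - P.[z]).
  rewrite addrCA subrr addr0; lra.
have [|u su uQ] := @poly_inverse_in_l1 R Q.
  by move=> z /hQ h; rewrite -normc_eq0 gt_eqF // (lt_le_trans d'0).
have hu N : bounded_by (u ^+ N) (d'^-1 ^+ N).
  rewrite exprVn; apply: (@inverse_coef_bound _ _ (Q ^+ N)).
  - exact: in_l1X.
  - by rewrite rmorphXn -exprMn uQ expr1n.
  - exact: exprn_gt0.
  - move=> z z1; rewrite horner_exp normcX lerXn2r ?nnegrE ?normc_ge0 ?(ltW d'0) //.
    by rewrite hQ // z1.
pose v := fps_scale (rho%:C)^-1 u.
have hv N : l1le (v ^+ N) ((1 - rho^-1)^-1 * d'^-1 ^+ N).
  rewrite [_ * _ ^+ _]mulrC; apply: l1le_geometric; rewrite ?invr_ge0 ?(ltW rho0) //.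
    by rewrite invf_lt1.
  move=> n; rewrite -fps_scaleX /fps_scale normcM normcX Normc.normcV normc_real.
  by rewrite gtr0_norm // ler_wpM2r ?exprn_ge0 ?invr_ge0 ?(ltW rho0) //; exact: hu.
exists v, (1 - rho^-1)^-1; split => //; last first.
  by exists ((1 - rho^-1)^-1 * d'^-1 ^+ 1); rewrite -[v]expr1.
rewrite -(fps_scale1 (rho%:C)^-1) -uQ fps_scaleM; congr (_ * _).
apply: funext => n; rewrite /fps_scale /fps_of_poly coef_poly.
case: ltnP => h; last by rewrite nth_default // mul0r.
by rewrite -mulrA exprVn mulfV ?mulr1 // expf_neq0.
Qed.

(** Here P is a truncation of q, u = 1/P and h = P - q: since q divides P^N - h^N,
    the series g = u^N (P^N - h^N) / q satisfies 1 - q g = (u h)^N. *)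
Lemma near_inverse (R : realType) (q : fps R[i]) (d : R) (L0 : nat) :
  in_l1 q -> 0 < d ->
  (forall K z, (L0 <= K)%N -> normc z <= 1 -> d <= normc (trunc K q).[z]) ->
  exists g e, [/\ in_l1 g, q * g = 1 - e & l1le e (1 / 2)].
Proof.
move=> sq d0 hq.
have d30 : 0 < d / 3 by lra.
have [L hL] := tail_small sq d30.
pose K := maxn L L0; have {hL}hL := hL K (leq_maxl _ _).
have {}hq z := hq K z (leq_maxr _ _).
set P := trunc K q in hL hq.
have d20 : 0 < d / 2 by lra.
have dd : d / 2 < d by lra.
have [u [C [uP su hu]]] := poly_inverse_powers d20 dd hq.
pose h := fps_of_poly P - q.
have hh : l1le h (d / 3) by rewrite /h -opprB; exact: l1leN.
have C0 : 0 <= C by have := l1le_ge0 (hu 0%N); rewrite expr0 mulr1.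
have [N hN] : exists N, C * (2 / 3) ^+ N <= 1 / 2 :> R.
  have [r1 r2] : 0 <= 2 / 3 :> R /\ 2 / 3 < 1 :> R by split; lra.
  have : (2 / 3 : R) ^+ n @[n --> \oo] --> 0.
    by apply: cvg_expr; rewrite ger0_norm.
  move/cvgrPdist_lt => /(_ ((C + 1)^-1 / 2)) [].
    by rewrite divr_gt0 // invr_gt0 ltr_wpDl.
  move=> N _ /(_ N (leqnn N)); rewrite sub0r normrN ger0_norm ?exprn_ge0 // => hN.
  exists N; have C1 : 0 < C + 1 by rewrite ltr_wpDl.
  apply: (@le_trans _ _ ((C + 1) * (2 / 3) ^+ N)).
    by rewrite ler_wpM2r ?exprn_ge0 //; lra.
  apply: (@le_trans _ _ ((C + 1) * ((C + 1)^-1 / 2))).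
    by rewrite ler_pM2l // (ltW hN).
  by rewrite mulrA mulfV ?gt_eqF.
pose pP := fps_of_poly P.
exists (u ^+ N * \sum_(i < N) pP ^+ (N.-1 - i) * h ^+ i), (u ^+ N * h ^+ N); split.
- apply: in_l1M; first exact: in_l1X.
  apply: in_l1_sum => i _; apply: in_l1M; apply: in_l1X.
    exact: in_l1_poly.
  by exists (d / 3).
- have {1}-> : q = pP - h by rewrite /h /pP; ring.
  rewrite mulrCA -subrXX mulrBr; congr (_ - _).
  by rewrite -exprMn uP expr1n.
- apply: l1le_le (l1leM (hu N) (l1leX N hh)) _.
  rewrite -mulrA -exprMn; have -> : (d / 2)^-1 * (d / 3) = 2 / 3.
    by field; rewrite gt_eqF.
  exact: hN.
Qed.

(** * Convergence of complex power series *)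

Lemma normc_ReIm (R : rcfType) (x y : R) : normc (x +i* y) <= `|x| + `|y|.
Proof.
rewrite -(@ler_sqr _ (normc _)) ?nnegrE ?normc_ge0 ?addr_ge0 //.
rewrite sqr_sqrtr ?addr_ge0 ?sqr_ge0 //.
rewrite sqrrD !real_normK ?num_real // lerD2r lerDl mulrn_wge0 // mulr_ge0.
Qed.

Lemma Re_le_normc (R : rcfType) (z : R[i]) : `|complex.Re z| <= normc z.
Proof. by rewrite -lecR; exact: normc_ge_Re. Qed.

Lemma Im_le_normc (R : rcfType) (z : R[i]) : `|complex.Im z| <= normc z.
Proof.
by case: z => x y; rewrite /normc /= -sqrtr_sqr ler_wsqrtr // lerDr sqr_ge0.
Qed.

Lemma truncE (K : comNzRingType) n (c : fps K) (z : K) :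
  (trunc n c).[z] = \sum_(i < n) c i * z ^+ i.
Proof. exact: horner_poly. Qed.

Definition sums_to (K : numFieldType) (c : fps K) (z l : K) : Prop :=
  (fun n => (trunc n c).[z]) @ \oo --> l.

Lemma sums_to_normP (K : numFieldType) (c : fps K) (z l : K) :
  sums_to c z l <-> forall e : K, 0 < e ->
    exists N, forall n, (N <= n)%N -> `|(trunc n c).[z] - l| < e.
Proof.
split=> [/cvgrPdist_lt h e e0|h].
  by have [N _ hN] := h e e0; exists N => n Nn; rewrite distrC; exact: hN.
apply/cvgrPdist_lt => e e0; have [N hN] := h e e0.
by exists N => // n Nn; rewrite distrC; exact: hN.
Qed.

Lemma sums_toP (R : realType) (c : fps R[i]) (z l : R[i]) :
  sums_to c z l <-> forall e : R, 0 < e ->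
    exists N, forall n, (N <= n)%N -> normc ((trunc n c).[z] - l) < e.
Proof.
split=> [/sums_to_normP h e e0|h].
  have := h e%:C; rewrite ltcR => /(_ e0) [N hN]; exists N => n Nn.
  by have := hN n Nn; rewrite normcE ltcR.
apply/sums_to_normP => -[e e']; rewrite ltcE /= => /andP[/eqP -> e0].
have [N hN] := h e e0; exists N => n Nn.
by rewrite normcE -/(real_complex R e) ltcR; exact: hN.
Qed.

(** The real and imaginary parts are absolutely convergent real series. *)
Lemma l1_sums (R : realType) (c : fps R[i]) (z : R[i]) :
  in_l1 c -> normc z <= 1 -> exists l, sums_to c z l.
Proof.
move=> [M hM] z1.
have comp (f : R[i] -> R) : (forall w, `|f w| <= normc w) ->
    cvgn (series (fun i => f (c i * z ^+ i))).
  move=> hf; apply: normed_cvg; apply: nondecreasing_is_cvgn.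
    apply: nondecreasing_series => i _ _; exact: normr_ge0.
  exists M => _ [n _ <-] /=; rewrite seriesEord.
  apply: le_trans (hM n); apply: ler_sum => i _.
  apply: le_trans (hf _) _; rewrite normcM normcX -[leRHS]mulr1.
  by rewrite ler_wpM2l ?normc_ge0 // exprn_ile1 // normc_ge0.
have := comp (@complex.Re R) (@Re_le_normc R).
have := comp (@complex.Im R) (@Im_le_normc R).
move=> /cvg_ex [y hy] /cvg_ex [x hx]; exists (x +i* y); apply/sums_toP => e e0.
have e20 : 0 < e / 2 by lra.
move/cvgrPdist_lt: hx => /(_ _ e20) [N1 _ h1].
move/cvgrPdist_lt: hy => /(_ _ e20) [N2 _ h2].
exists (maxn N1 N2) => n; rewrite geq_max => /andP[n1 n2].
have := h1 n n1; have := h2 n n2; rewrite !seriesEord.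
rewrite truncE => {}h2 {}h1.
have -> : \sum_(i < n) c i * z ^+ i - x +i* y =
    (\sum_(i < n) complex.Re (c i * z ^+ i) - x) +i*
    (\sum_(i < n) complex.Im (c i * z ^+ i) - y).
  by rewrite -(raddf_sum (@complex.Re R)) -(raddf_sum (@complex.Im R));
    case: (\sum_(i < n) _).
apply: le_lt_trans (normc_ReIm _ _) _; rewrite distrC (distrC _ y); lra.
Qed.

Lemma powser_partial0E (K : numFieldType) (c : fps K) (z : K) :
  powser_partial 0 c z = (fun n => (trunc n c).[z]).
Proof. by apply: funext => n; rewrite /powser_partial truncE big_mkord. Qed.

Lemma sums_to_unique (K : numFieldType) (c : fps K) z l :
  sums_to c z l -> powser_sum 0 c z = l.
Proof.
move=> h; rewrite /powser_sum powser_partial0E; exact: cvg_lim.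
Qed.

Lemma powser_partial1E (K : numFieldType) (c : fps K) (z : K) :
  powser_partial 1 c z =
  powser_partial 0 (fun n => if n is n'.+1 then c n else 0) z.
Proof.
apply: funext => n; rewrite /powser_partial.
case: n => [|n]; first by rewrite !big_geq.
rewrite [in RHS]big_ltn // mul0r add0r !big_add1 /=.
exact: eq_bigr.
Qed.

Lemma sums_to_linear_factor (K : numFieldType) (c : fps K) w z l :
  sums_to c z l -> sums_to (fps_of_poly (linear_factor w) * c) z ((1 - w * z) * l).
Proof.
rewrite /sums_to => h; rewrite -cvg_shiftS.
have -> : (fun n => (trunc n.+1 (fps_of_poly (linear_factor w) * c)).[z]) =
    (fun n => (trunc n.+1 c).[z] - (w * z) * (trunc n c).[z]).
  apply: funext => n; rewrite !truncE big_ord_recl [in RHS]big_ord_recl /=.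
  rewrite fpsM_coef0 /fps_of_poly coefB coef1 coefZ coefX /= mulr0 subr0 mul1r.
  rewrite -addrA; congr (_ + _); rewrite mulr_sumr -sumrB; apply: eq_bigr => i _.
  by rewrite fpsM_linear_factorS /bump /= add1n exprS; ring.
rewrite mulrBl mul1r; apply: cvgB.
  by rewrite (cvg_shiftS (fun n => (trunc n c).[z])).
by apply: cvgM h; exact: cvg_cst.
Qed.

Lemma sums_to_prod (K : numFieldType) (c : fps K) z l (I : Type) (r : seq I)
    (w : I -> K) (m : I -> nat) : sums_to c z l ->
  sums_to ((\prod_(j <- r) fps_of_poly (linear_factor (w j)) ^+ m j) * c) z
    ((\prod_(j <- r) (1 - w j * z) ^+ m j) * l).
Proof.
move=> h; elim: r => [|j r IH]; first by rewrite !big_nil !mul1r.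
rewrite !big_cons -!mulrA; elim: (m j) => [|k IHk]; first by rewrite !expr0 !mul1r.
by rewrite !exprS -!mulrA; exact: sums_to_linear_factor.
Qed.

Lemma sums_toB (K : numFieldType) (c d : fps K) z l l' :
  sums_to c z l -> sums_to d z l' -> sums_to (c - d) z (l - l').
Proof.
move=> hc hd; rewrite /sums_to.
have -> : (fun n => (trunc n (c - d)).[z]) =
    (fun n => (trunc n c).[z] - (trunc n d).[z]).
  apply: funext => n; rewrite !truncE -sumrB; apply: eq_bigr => i _.
  by rewrite fpsDE fpsNE mulrBl.
exact: cvgB.
Qed.

Lemma sums_to1 (K : numFieldType) (z : K) : sums_to 1 z 1.
Proof.
apply/sums_to_normP => e e0; exists 1%N => -[//|n] _.
rewrite truncE big_ord_recl fps1E big1 => [|i _]; last by rewrite fps1E mul0r.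
by rewrite addr0 mulr1 subrr normr0.
Qed.

Lemma sums_to_bounded (R : realType) (c : fps R[i]) l :
  sums_to c 1 l -> exists B, bounded_by c B.
Proof.
move=> /sums_toP /(_ 1 ltr01) [N hN].
have B0 : 0 <= \sum_(i < N) normc (c i) by apply: sumr_ge0 => i _; exact: normc_ge0.
exists (2 + \sum_(i < N) normc (c i)) => n; have [nN|Nn] := ltnP n N.
  rewrite (bigD1 (Ordinal nN)) //= addrCA lerDl addr_ge0 //.
  by apply: sumr_ge0 => i _; exact: normc_ge0.
have h1 := hN n Nn; have h2 := hN n.+1 (leqW Nn).
have -> : c n = ((trunc n.+1 c).[1] - l) - ((trunc n c).[1] - l).
  by rewrite !truncE big_ord_recr /= expr1n mulr1; ring.
have := normcB_le ((trunc n.+1 c).[1] - l) ((trunc n c).[1] - l); lra.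
Qed.

(** Identity theorem: c_0 = c(t) - t c'(t) with c(t) = 0 and |c'(t)| <= B / (1 - t),
    and the right-hand side tends to 0 with t. *)
Lemma sums_to_zero_coef0 (R : realType) (c : fps R[i]) (B : R) :
  bounded_by c B ->
  (forall t : R, 0 < t -> t < 1 -> sums_to c t%:C 0) -> c 0%N = 0.
Proof.
move=> hB h0; apply/eqP; rewrite -normc_eq0 eq_le normc_ge0 andbT.
have B0 : 0 <= B := le_trans (normc_ge0 _) (hB 0%N).
apply/ler_addgt0Pr => eps e0; rewrite add0r.
pose t : R := Num.min (1 / 2) (eps / (4 * (B + 1))).
have B1 : 0 < 4 * (B + 1) by lra.
have t0 : 0 < t by rewrite /t lt_min !divr_gt0 //; lra.
have t1 : t <= 1 / 2 by rewrite /t ge_min lexx.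
have t2 : t * (4 * (B + 1)) <= eps by rewrite -ler_pdivlMr // /t ge_min lexx orbT.
have tlt1 : t < 1 by lra.
have e20 : 0 < eps / 2 by lra.
have [N hN] := (iffLR (sums_toP _ _ _)) (h0 t t0 tlt1) _ e20.
have := hN N.+1 (leqnSn N); rewrite subr0 truncE big_ord_recl expr0 mulr1.
set T := \sum_(i < N) _ => hT.
have hT' : normc T <= t * (B / (1 - t)).
  have -> : T = t%:C * \sum_(i < N) fps_scale t%:C (fun n => c n.+1) i.
    rewrite mulr_sumr; apply: eq_bigr => i _.
    by rewrite /fps_scale lift0 exprS; ring.
  rewrite normcM normc_real gtr0_norm // ler_pM2l //.
  apply: le_trans (normc_sum _ _ _) _.
  apply: (@l1le_geometric _ (fps_scale t%:C (fun n => c n.+1))) => //; first exact: ltW.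
  move=> n; rewrite /fps_scale normcM normcX normc_real gtr0_norm //.
  by rewrite ler_wpM2r ?exprn_ge0 ?(ltW t0).
have hB2 : B / (1 - t) <= 2 * B.
  by rewrite ler_pdivrMr ?subr_gt0 // -[X in X <= _]mulr1; nra.
have := normcB_ge (c 0%N) T.
have : t * (B / (1 - t)) <= t * (2 * B) by rewrite ler_pM2l.
nra.
Qed.

Lemma sums_to_zero (R : realType) (c : fps R[i]) (B : R) :
  bounded_by c B ->
  (forall t : R, 0 < t -> t < 1 -> sums_to c t%:C 0) -> c = 0.
Proof.
move=> hB h0; apply: funext => k.
elim: k c hB h0 => [|k IH] c hB h0; first exact: sums_to_zero_coef0 hB h0.
apply: (IH (fun n => c n.+1)) => [n|t t0 t1]; first exact: hB.
have c00 := sums_to_zero_coef0 hB h0.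
apply/sums_toP => e e0; have [|N hN] := (iffLR (sums_toP _ _ _)) (h0 t t0 t1) (e * t).
  exact: mulr_gt0.
exists N => n Nn; have := hN n.+1 (leqW Nn).
rewrite !subr0 !truncE big_ord_recl c00 mul0r add0r.
have -> : \sum_(i < n) c (lift ord0 i) * t%:C ^+ lift ord0 i =
    t%:C * \sum_(i < n) c i.+1 * t%:C ^+ i.
  rewrite mulr_sumr; apply: eq_bigr => i _.
  by rewrite lift0 exprS; ring.
by rewrite normcM normc_real gtr0_norm // mulrC ltr_pM2r.
Qed.

(** * Uniform lower bound for the truncations *)

(** Near z the truncation of order L stays above 2 |l| / 4 because it is
    continuous, and every longer one differs from it by at most |l| / 4 on the
    whole disc because q is summable. *)
Lemma trunc_lower_bound_near (R : realType) (q : fps R[i]) (z l : R[i]) :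
  in_l1 q -> normc z <= 1 -> sums_to q z l -> l <> 0 ->
  exists eta : R, 0 < eta /\ exists N, forall z' n k,
    normc (z' - z) < eta -> normc z' <= 1 -> (N <= n)%N -> (n <= k)%N ->
    n.+1%:R^-1 <= normc (trunc k q).[z'].
Proof.
move=> sq z1 hl l0; pose c := normc l / 4.
have lE : normc l = 4 * c by rewrite /c; lra.
have c0 : 0 < c.
  by rewrite /c divr_gt0 // lt_def normc_ge0 andbT normc_eq0; exact/eqP.
have c20 : 0 < c / 2 by lra.
have [L1 hL1] := tail_small sq c20.
have [L2 hL2] := iffLR (sums_toP _ _ _) hl c c0.
pose L := maxn L1 L2.
have h3 : 3 * c <= normc (trunc L q).[z].
  have := hL2 L (leq_maxr _ _); have := normcB_ge l ((trunc L q).[z] - l).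
  by rewrite addrCA subrr addr0 lE; lra.
have [C C0 hC] := horner_lipschitz (trunc L q) (@ler01 R).
have C1 : 0 < C + 1 by rewrite ltr_wpDl.
have [N _ hN] := near_infty_natSinv_lt (PosNum c0).
exists (c / (C + 1)); split; first exact: divr_gt0.
exists (maxn L N) => z' n k hz z'1; rewrite geq_max => /andP[Ln Nn] nk.
have h4 : normc ((trunc L q).[z'] - (trunc L q).[z]) <= c.
  apply: le_trans (hC z' z z'1 z1) _.
  have : normc (z' - z) * (C + 1) <= c by rewrite -ler_pdivlMr // ltW.
  by have := normc_ge0 (z' - z); nra.
have h5 : normc ((trunc k q).[z'] - (trunc L q).[z']) <= c.
  rewrite -hornerN -hornerD; apply: normc_horner_le z'1.
  have -> : fps_of_poly (trunc k q - trunc L q) =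
      (q - fps_of_poly (trunc L q)) - (q - fps_of_poly (trunc k q)).
    by rewrite rmorphB; ring.
  have -> : c = c / 2 + c / 2 by lra.
  apply: l1leD; first by apply: hL1; rewrite leq_maxl.
  apply: l1leN; apply: hL1.
  by rewrite (leq_trans (leq_maxl _ L2)) // (leq_trans Ln).
have h6 := normcB_ge (trunc L q).[z] ((trunc L q).[z'] - (trunc L q).[z]).
have h7 := normcB_ge (trunc L q).[z'] ((trunc k q).[z'] - (trunc L q).[z']).
rewrite addrCA subrr addr0 in h6; rewrite addrCA subrr addr0 in h7.
have hn : n.+1%:R^-1 < c := hN n Nn.
have a1 : 2 * c <= normc (trunc L q).[z'] by clear - h3 h4 h6; lra.
have a2 : c <= normc (trunc k q).[z'] by clear - a1 h5 h7; lra.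
by rewrite (le_trans (ltW hn)).
Qed.

(** The local bounds are stated with 1 / (n + 1) for large n so that compactness,
    in the form of near coverings, provides one n for the whole disc. The disc
    is covered through the square [-1, 1] x [-1, 1]. *)
Lemma trunc_lower_bound (R : realType) (q : fps R[i]) :
  in_l1 q -> (forall z l, normc z <= 1 -> sums_to q z l -> l <> 0) ->
  exists2 d : R, 0 < d & exists L0, forall K z, (L0 <= K)%N -> normc z <= 1 ->
    d <= normc (trunc K q).[z].
Proof.
move=> sq hq.
pose P (n : nat) (p : R * R) := normc (p.1 +i* p.2) <= 1 ->
  forall k, (n <= k)%N -> n.+1%:R^-1 <= normc (trunc k q).[p.1 +i* p.2].
have cK : compact (`[-1, 1]%classic `*` `[-1, 1]%classic : set (R * R)).
  by apply: compact_setX; exact: segment_compact.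
have nb (p : R * R) (eta : R) : 0 < eta ->
    \forall p' \near p, normc (p'.1 +i* p'.2 - p.1 +i* p.2) < eta.
  move=> eta0; apply/nbhs_ballP; exists (eta / 2); first by rewrite /= divr_gt0.
  move=> p' [/= h1 h2]; rewrite /ball /= in h1 h2.
  apply: le_lt_trans (normc_ReIm _ _) _.
  rewrite distrC (distrC p'.2); lra.
have /compact_near_coveringP /(_ nat \oo P _) := cK.
case.
  move=> [x y] _; pose z : R[i] := (x : R) +i* (y : R).
  have [z1|z1] := leP (normc z) 1; last first.
    (* Points outside the disc have a neighbourhood outside the disc. *)
    have e0 : 0 < normc z - 1 by lra.
    exists ([set p' | normc (p'.1 +i* p'.2 - z) < normc z - 1], setT).
      by split; [exact: (nb (x, y)) | exact: filterT].
    move=> [p' n] /= [hp _] hp1; exfalso.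
    have := normcB_ge z (p'.1 +i* p'.2 - z); rewrite addrCA subrr addr0; lra.
  have [l hl] := l1_sums sq z1.
  have [eta [eta0 [N hN]]] := trunc_lower_bound_near sq z1 hl (hq z l z1 hl).
  exists ([set p' | normc (p'.1 +i* p'.2 - z) < eta], [set n | (N <= n)%N]).
    by split; [exact: (nb (x, y)) | exists N].
  by move=> [p' n] /= [hp Nn] hp1 k nk; exact: hN hp hp1 Nn nk.
move=> N _ hN; exists N.+1%:R^-1; first by rewrite invr_gt0.
exists N => K z NK z1.
have := hN N (leqnn N) (complex.Re z, complex.Im z); rewrite /P /=.
have -> : complex.Re z +i* complex.Im z = z by case: (z).
apply => //.
by split; rewrite /= in_itv /= -ler_norml (le_trans _ z1) // (Re_le_normc, Im_le_normc).
Qed.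

(** * Products and quotients by linear factors *)

Lemma fpsCM (K : comNzRingType) (a : K) (c : fps K) n :
  (fps_of_poly a%:P * c) n = a * c n.
Proof.
rewrite fpsME big_ord_recl subn0 big1 ?addr0 => [|i _].
  by rewrite /fps_of_poly coefC eqxx.
by rewrite /fps_of_poly coefC mul0r.
Qed.

Lemma l1le_const (R : rcfType) (a : R[i]) (c : fps R[i]) M :
  l1le c M -> l1le (fps_of_poly a%:P * c) (normc a * M).
Proof.
move=> hc N; under eq_bigr do rewrite fpsCM normcM.
by rewrite -mulr_sumr ler_wpM2l ?normc_ge0.
Qed.

Lemma bounded_by_const (R : rcfType) (a : R[i]) (c : fps R[i]) B :
  bounded_by c B -> bounded_by (fps_of_poly a%:P * c) (normc a * B).
Proof. by move=> hc n; rewrite fpsCM normcM ler_wpM2l ?normc_ge0. Qed.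

Lemma geom2E (K : comNzRingType) (w : K) n : (geom w ^+ 2) n = w ^+ n *+ n.+1.
Proof.
rewrite expr2 fpsME (eq_bigr (fun=> w ^+ n)) ?sumr_const ?card_ord // => i _.
by rewrite /geom -exprD subnKC // -ltnS.
Qed.

Lemma bounded_by_geom (R : rcfType) (w : R[i]) : normc w = 1 -> bounded_by (geom w) 1.
Proof. by move=> w1 n; rewrite normcX w1 expr1n. Qed.

(** Partial fractions, as an induction on the number of factors: for distinct
    w0 and w, 1 / ((1 - w0 X) (1 - w X)) is the combination
    (w0 / (1 - w0 X) - w / (1 - w X)) / (w0 - w). The last clause allows one more
    factor, which is what the next step of the induction uses. *)
Lemma linear_factors_bounded_inverse (R : rcfType) (ws : seq R[i]) :
  uniq ws -> (forall w, w \in ws -> normc w = 1) ->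
  exists b, [/\ b * \prod_(w <- ws) fps_of_poly (linear_factor w) = 1,
    exists B, bounded_by b B &
    forall w, w \notin ws -> normc w = 1 -> exists B, bounded_by (b * geom w) B].
Proof.
elim: ws => [|w0 ws IH] /=.
  move=> _ _; exists 1; split; first by rewrite big_nil mulr1.
    by exists 1; apply: l1le_bounded; exact: l1le1.
  by move=> w _ w1; exists 1; rewrite mul1r; exact: bounded_by_geom.
move=> /andP[w0ws uws] h1.
have w01 : normc w0 = 1 by apply: h1; rewrite mem_head.
have [w wws|b [hb _ hbw]] := IH uws; first by apply: h1; rewrite inE wws orbT.
exists (b * geom w0); split.
- by rewrite big_cons [_ * \prod_(_ <- _) _]mulrC mulrACA hb mul1r mulrC
    linear_factor_geom.
- exact: hbw.
move=> w; rewrite inE negb_or => /andP[ww0 wws] w1.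
have [B hB] := hbw w wws w1; have [B0 hB0] := hbw w0 w0ws w01.
have E : geom w0 * geom w =
    fps_of_poly (w0 / (w0 - w))%:P * geom w0 - fps_of_poly (w / (w0 - w))%:P * geom w.
  have d0 : w0 - w != 0 by rewrite subr_eq0 eq_sym.
  apply: funext => n; rewrite [RHS]fpsDE fpsNE !fpsCM /geom.
  have -> : w0 / (w0 - w) * w0 ^+ n - w / (w0 - w) * w ^+ n =
      (w0 ^+ n.+1 - w ^+ n.+1) / (w0 - w) by rewrite !exprS; field.
  rewrite subrXX mulrAC divff // mul1r fpsME /=.
  rewrite (reindex_inj rev_ord_inj) /=; apply: eq_bigr => i _.
  by rewrite subSS subKn // -ltnS.
exists (normc (w0 / (w0 - w)) * B0 + normc (w / (w0 - w)) * B).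
have -> : b * geom w0 * geom w =
    fps_of_poly (w0 / (w0 - w))%:P * (b * geom w0) +
    fps_of_poly (- (w / (w0 - w)))%:P * (b * geom w).
  by rewrite -mulrA E polyCN rmorphN; ring.
apply: bounded_byD; first exact: bounded_by_const.
by rewrite -(normcN (w / _)); exact: bounded_by_const.
Qed.

(** y = x0 g + y e, and the second term is at most half of the partial sum of |y|
    on the left. *)
Lemma l1_of_near_inverse (R : rcfType) (y q g e : fps R[i]) (x0 : R[i]) G :
  y * q = fps_of_poly x0%:P -> q * g = 1 - e -> l1le g G -> l1le e (1 / 2) ->
  l1le y (2 * (normc x0 * G)).
Proof.
move=> yq qg hg he N.
have E : y = fps_of_poly x0%:P * g + y * e.
  by rewrite -yq -mulrA qg mulrBr mulr1 subrK.
have h1 := l1le_const x0 hg N; have h2 := psum_normM y N he.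
suff : \sum_(k < N) normc (y k) <=
    \sum_(k < N) normc ((fps_of_poly x0%:P * g) k) + \sum_(k < N) normc ((y * e) k).
  move: h1 h2; lra.
rewrite -big_split /=; apply: ler_sum => k _; rewrite {1}E; exact: normcD_le.
Qed.

(** * The Volterra equation *)

Definition kernel_fps (R : realType) (a : nat -> R) : fps R[i] :=
  fun n => if n is n'.+1 then (a n)%:C else 0.

Definition fps_of_real (R : realType) (x : nat -> R) : fps R[i] := fun n => (x n)%:C.

Lemma volterra_fps (R : realType) (a x : nat -> R) :
  volterra_solution a x ->
  fps_of_real x * (1 - kernel_fps a) = fps_of_poly (x 0%N)%:C%:P.
Proof.
move=> hx; apply: funext => n; rewrite mulrBr mulr1 fpsDE fpsNE fpsME big_ord_recr /=.
rewrite subnn /= mulr0 addr0 /fps_of_poly coefC /fps_of_real.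
case: n => [|n]; first by rewrite big_ord0 subr0.
rewrite hx // big_mkord rmorph_sum /= -sumrB big1 // => i _.
by rewrite -[X in kernel_fps a X]prednK ?subn_gt0 // /kernel_fps prednK ?subn_gt0 //
  rmorphM /= mulrC subrr.
Qed.

(** Stability only constrains the solutions that exist, so instability needs a
    solution for every initial value; it is built as a growing list of values. *)
Lemma volterra_exists (R : realType) (a : nat -> R) (x0 : R) :
  exists2 x, volterra_solution a x & x 0%N = x0.
Proof.
pose nxt (s : seq R) := \sum_(0 <= i < size s) a (size s - i)%N * s`_i.
pose S n := iter n (fun s => rcons s (nxt s)) [:: x0].
have sizeS n : size (S n) = n.+1 by elim: n => //= n IH; rewrite size_rcons IH.
have nthS n k : (k <= n)%N -> (S n)`_k = (S k)`_k.
  elim: n => [|n IH]; first by rewrite leqn0 => /eqP ->.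
  rewrite leq_eqVlt => /predU1P[-> //|kn].
  by rewrite /= nth_rcons sizeS kn IH.
exists (fun n => (S n)`_n) => // -[//|n] _.
rewrite /= nth_rcons sizeS ltnn eqxx /nxt sizeS.
rewrite !big_mkord; apply: eq_bigr => i _.
by rewrite nthS // -ltnS.
Qed.

Lemma expiN (R : realType) (t : R) : expi (- t) = (expi t)^*%C.
Proof. by rewrite /expi cosN sinN. Qed.

Lemma normc_expi (R : realType) (t : R) : normc (expi t) = 1.
Proof. by rewrite /normc /expi cos2Dsin2 sqrtr1. Qed.

(** Both sides have bounded coefficients, as 1 - a(z) converges at z = 1, so the
    identity theorem applies to their difference. *)
Lemma factorization_fps (R : realType) (a : nat -> R) (q : fps R[i]) (s : nat)
    (w : 'I_s -> R[i]) (m : 'I_s -> nat) :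
  (forall z : R[i], `|z| <= 1 -> powser_cvg 1 (fun n => (a n)%:C) z) ->
  in_l1 q ->
  (forall z : R[i], `|z| <= 1 -> 1 - powser_sum 1 (fun n => (a n)%:C) z =
     (\prod_(j < s) (1 - w j * z) ^+ m j) * powser_sum 0 q z) ->
  1 - kernel_fps a = \prod_(j < s) fps_of_poly (linear_factor (w j)) ^+ m j * q.
Proof.
move=> acvg ql1 factE.
set g := \prod_(j < s) _.
have hk z : normc z <= 1 ->
    sums_to (kernel_fps a) z (powser_sum 1 (fun n => (a n)%:C) z).
  move=> z1; have z1' : `|z| <= 1 by rewrite normcE lecR.
  have := acvg z z1'; rewrite /powser_cvg /powser_sum powser_partial1E.
  by rewrite powser_partial0E.
have hd z : normc z <= 1 -> sums_to ((1 - kernel_fps a) - g * q) z 0.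
  move=> z1; have z1' : `|z| <= 1 by rewrite normcE lecR.
  have [l hl] := l1_sums ql1 z1.
  have := sums_toB (sums_toB (sums_to1 z) (hk z z1))
    (@sums_to_prod _ _ _ _ _ (index_enum 'I_s) w m hl).
  by rewrite factE // (sums_to_unique hl) subrr.
have [B hB] : exists B, bounded_by ((1 - kernel_fps a) - g * q) B.
  by apply: (@sums_to_bounded _ _ 0); apply: hd; rewrite Normc.normc1.
apply/eqP; rewrite -subr_eq0; apply/eqP; apply: (sums_to_zero hB) => t t0 t1.
by apply: hd; rewrite normc_real gtr0_norm // ltW.
Qed.

Lemma stable_of_simple (R : realType) (a : nat -> R) (q : fps R[i]) (ws : seq R[i]) :
  uniq ws -> (forall w, w \in ws -> normc w = 1) -> in_l1 q ->
  (forall z l, normc z <= 1 -> sums_to q z l -> l <> 0) ->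
  1 - kernel_fps a = \prod_(w <- ws) fps_of_poly (linear_factor w) * q ->
  null_solution_stable a.
Proof.
move=> uws ws1 ql1 q0 factE.
have [d d0 [L0 hd]] := trunc_lower_bound ql1 q0.
have [g [e [[G hG] qg he]]] := near_inverse ql1 d0 hd.
have [b [hb [B hB] _]] := linear_factors_bounded_inverse uws ws1.
have G0 := l1le_ge0 hG; have B0 : 0 <= B := le_trans (normc_ge0 _) (hB 0%N).
pose C := B * (2 * G) + 1.
have C0 : 0 < C by rewrite /C ltr_wpDl // !mulr_ge0.
move=> eps e0; exists (eps / C); first exact: divr_gt0.
move=> x hx; rewrite ltr_pdivlMr // => x0 n.
have hX := volterra_fps hx; rewrite factE mulrA in hX.
have hy := l1_of_near_inverse hX qg hG he.
have E : fps_of_real x =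
    b * (fps_of_real x * \prod_(w <- ws) fps_of_poly (linear_factor w)).
  by rewrite mulrCA hb mulr1.
have := bounded_byM_l1 hB hy n; rewrite -E /fps_of_real !normc_real => h.
apply: le_lt_trans h _; apply: le_lt_trans x0.
have := normr_ge0 (x 0%N); rewrite /C; nra.
Qed.

Lemma not_stable_of_double (R : realType) (a : nat -> R) (F : fps R[i]) (w : R[i]) :
  normc w = 1 -> in_l1 F ->
  1 - kernel_fps a = fps_of_poly (linear_factor w) ^+ 2 * F -> ~ null_solution_stable a.
Proof.
move=> w1 [M hM] factE /(_ 1 ltr01) [d d0 hd].
have [x hx x0] := volterra_exists a (d / 2).
have xlt : `|x 0%N| < d by rewrite x0 gtr0_norm; lra.
have hb : bounded_by (fps_of_real x) 1.
  by move=> n; rewrite normc_real ltW // hd.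
have E : fps_of_real x * F = fps_of_poly (x 0%N)%:C%:P * geom w ^+ 2.
  rewrite -(volterra_fps hx) factE -mulrA [_ ^+ 2 * F]mulrC -mulrA -exprMn.
  by rewrite linear_factor_geom expr1n mulr1.
have M1 : 0 < 2 * M + 1 by have := l1le_ge0 hM; lra.
(* For this n the coefficient (n + 1) d / 2 of x F exceeds M. *)
have [n hn] := near_infty_natSinv_lt (PosNum (divr_gt0 d0 M1)).
move=> /(_ n (leqnn n)) /=.
have := bounded_byM_l1 hb hM n; rewrite E fpsCM geom2E mul1r normcM normcMn normcX w1.
rewrite expr1n normc_real x0 gtr0_norm; last lra.
move=> h1 h2.
have n0 : 0 < n.+1%:R :> R by rewrite ltr0n.
have : n.+1%:R^-1 * n.+1%:R * (2 * M + 1) < d * n.+1%:R.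
  rewrite -ltr_pdivlMr // mulrAC ltr_pM2r //; lra.
rewrite mulVf ?gt_eqF // mul1r => h3.
have : d / 2 * n.+1%:R <= M := h1.
lra.
Qed.

Theorem theorem10 (R : realType) (a : nat -> R)
  (s : nat) (theta : 'I_s -> R) (m : 'I_s -> nat) (q : nat -> R[i])
  (a_cvg : forall z : R[i], `|z| <= 1 ->
     powser_cvg 1 (fun n => (a n)%:C) z)
  (zeros_distinct : injective (fun j => expi (theta j)))
  (zerosP : forall z : R[i], `|z| <= 1 ->
     (1 - powser_sum 1 (fun n => (a n)%:C) z = 0 <-> exists j, z = expi (theta j)))
  (m_ge1 : forall j, (1 <= m j)%N)
  (q_ell1 : ell1 q)
  (q_neq0 : forall z : R[i], `|z| <= 1 -> powser_sum 0 q z <> 0)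
  (factorization : forall z : R[i], `|z| <= 1 ->
     1 - powser_sum 1 (fun n => (a n)%:C) z =
     (\prod_(j < s) (1 - expi (- theta j) * z) ^+ m j) * powser_sum 0 q z) :
  null_solution_stable a <-> (forall j, m j = 1%N).
Proof.
have ql1 : in_l1 (q : fps R[i]).
  exists (fine (\sum_(0 <= n <oo) (normc (q n))%:E)%E) => N.
  have S0 : (0 <= \sum_(0 <= n <oo) (normc (q n))%:E)%E.
    by apply: nneseries_ge0 => n _ _; rewrite lee_fin normc_ge0.
  rewrite -lee_fin fineK ?ge0_fin_numE // -sumEFin.
  rewrite -(big_mkord xpredT (fun n => (normc (q n))%:E)).
  by apply: nneseries_lim_ge => n _ _; rewrite lee_fin normc_ge0.
have q0 z l : normc z <= 1 -> sums_to q z l -> l <> 0.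
  move=> z1 hl; rewrite -(sums_to_unique hl); apply: q_neq0.
  by rewrite normcE lecR.
have factE := factorization_fps a_cvg ql1 factorization.
have w1 j : normc (expi (- theta j)) = 1 := normc_expi _.
split=> [hst j|hm].
  apply/eqP; rewrite eqn_leq m_ge1 andbT leqNgt; apply/negP => mj.
  pose L i := fps_of_poly (linear_factor (expi (- theta i))).
  pose F := L j ^+ (m j - 2) * \prod_(i < s | i != j) L i ^+ m i * q.
  move: hst; apply: (@not_stable_of_double _ _ F _ (w1 j)).
    apply: in_l1M => //; apply: in_l1M.
      by apply: in_l1X; exact: in_l1_poly.
    by apply: in_l1_prod => i _; apply: in_l1X; exact: in_l1_poly.
  by rewrite factE (bigD1 j) //= !mulrA -exprD subnKC.
apply: (@stable_of_simple _ _ q [seq expi (- theta j) | j <- enum 'I_s]) => //.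
- rewrite map_inj_uniq ?enum_uniq // => i j; rewrite !expiN => /(can_inj (@conjcK _)).
  exact: zeros_distinct.
- by move=> _ /mapP [j _ ->].
- rewrite factE big_map big_enum /=; congr (_ * _); apply: eq_bigr => j _.
  by rewrite hm expr1.
Qed.
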